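(* Let $k\ge1$ and consider rowmotion $\rho$ acting on $\mathcal{J}({\sf V}_k)$. For $s\in{\sf V}_k$ let $\chi_s:\mathcal{J}({\sf V}_k)\to\{0,1\}$ be the indicator function $\chi_s(I)=1$ iff $s\in I$. Then: (1) for every $i\in[k]$, the statistic $\chi_{\ell_i}-\chi_{r_i}$ is $0$-mesic; (2) the statistic $\chi_{\ell_1}+\chi_{r_1}-\chi_{c_k}$ is $\frac{2(k-1)}{k+2}$-mesic.
   Context: ${\sf V}$ is the 3-element poset with elements $c,\ell,r$ and relations $c<\ell$, $c<r$. ${\sf V}_k={\sf V}\times[k]$ with the product order, where $[k]=\{1<\dots<k\}$; write $\ell_i=(\ell,i)$, $c_i=(c,i)$, $r_i=(r,i)$. $\mathcal{J}(P)$ is the set of order ideals of $P$; rowmotion $\rho$ sends an order ideal $I$ to the order ideal generated by the minimal elements of $P\setminus I$. A statistic $g$ on a finite set $S$ is called $c$-mesic with respect to an invertible map $\varphi:S\to S$ if for every $\varphi$-orbit $\mathcal{O}$, $\frac{1}{\#\mathcal{O}}\sum_{x\in\mathcal{O}}g(x)=c$. *)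

(* Defs.v *)
From HB Require Import structures.
From mathcomp Require Import all_boot all_order all_fingroup all_algebra.

Set Implicit Arguments.
Unset Strict Implicit.
Unset Printing Implicit Defensive.

Import Order.Theory.

Section OrderIdeals.
Context {d : Order.disp_t} {P : finPOrderType d}.
Local Open Scope order_scope.

Definition is_order_ideal (I : {set P}) : bool :=
  [forall x, forall y, (x \in I) && (y <= x) ==> (y \in I)].

Definition generated_ideal (A : {set P}) : {set P} :=
  [set x | [exists a in A, x <= a]].

Definition minimal_elements (A : {set P}) : {set P} :=
  [set x in A | [forall y in A, ~~ (y < x)]].

Lemma generated_idealP (A : {set P}) : is_order_ideal (generated_ideal A).
Proof.
apply/forallP => x; apply/forallP => y; apply/implyP => /andP[].
rewrite !inE => /existsP[a /andP[aA xa]] yx.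
by apply/existsP; exists a; rewrite aA (le_trans yx).
Qed.

End OrderIdeals.

Record orderIdeal (d : Order.disp_t) (P : finPOrderType d) := OrderIdeal {
  ideal_set :> {set P};
  ideal_setP : is_order_ideal ideal_set
}.

HB.instance Definition _ (d : Order.disp_t) (P : finPOrderType d) :=
  [isSub for @ideal_set d P].
HB.instance Definition _ (d : Order.disp_t) (P : finPOrderType d) :=
  [Countable of orderIdeal P by <:].
HB.instance Definition _ (d : Order.disp_t) (P : finPOrderType d) :=
  [Finite of orderIdeal P by <:].

Section Rowmotion.
Context {d : Order.disp_t} {P : finPOrderType d}.
Local Open Scope order_scope.
Implicit Types I J : orderIdeal P.

Definition rowmotion_fun I : orderIdeal P :=
  OrderIdeal (generated_idealP (minimal_elements (~: (I : {set P})))).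

Lemma exists_minimal (A : {set P}) x :
  x \in A -> exists2 m, m \in minimal_elements A & m <= x.
Proof.
have [n] := ubnP #|[set y in A | y < x]|.
elim: n x => // n IHn x ltn xA.
case: (boolP (x \in minimal_elements A)) => [xm|]; first by exists x.
rewrite inE xA /= negb_forall => /existsP[y].
rewrite negb_imply negbK => /andP[yA yx].
have /IHn/(_ yA)[m mA my] : (#|[set z in A | (z < y)%O]| < n)%N.
  rewrite ltnS in ltn; apply: leq_trans ltn; apply: proper_card.
  apply/properP; split.
    by apply/subsetP => z; rewrite !inE => /andP[-> /lt_trans->].
  by exists y; rewrite !inE yA ?yx // ltxx.
by exists m => //; apply: le_trans my (ltW yx).
Qed.

Lemma minimal_sub (A B : {set P}) :
  generated_ideal (minimal_elements A) = generated_ideal (minimal_elements B) ->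
  minimal_elements A \subset minimal_elements B.
Proof.
move=> eqAB; apply/subsetP => x xA.
have /existsP[y /andP[yB xy]] : [exists y in minimal_elements B, x <= y].
  have : x \in generated_ideal (minimal_elements A).
    by rewrite inE; apply/existsP; exists x; rewrite xA lexx.
  by rewrite eqAB inE.
have /existsP[z /andP[zA yz]] : [exists z in minimal_elements A, y <= z].
  have : y \in generated_ideal (minimal_elements B).
    by rewrite inE; apply/existsP; exists y; rewrite yB lexx.
  by rewrite -eqAB inE.
suff -> : x = y by [].
have xz : x = z.
  move: (le_trans xy yz); rewrite le_eqVlt => /orP[/eqP //|xz].
  move: zA; rewrite inE => /andP[_ /forallP/(_ x)].
  by move: xA; rewrite inE => /andP[-> _]; rewrite xz.
by apply/le_anti; rewrite xy xz yz.
Qed.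

Lemma in_ideal_minimal I x :
  (x \notin (I : {set P})) =
  [exists m in minimal_elements (~: (I : {set P})), m <= x].
Proof.
apply/idP/existsP => [xI | [m /andP[]]].
  have xC : x \in ~: (I : {set P}) by rewrite inE.
  by have [m mI mx] := exists_minimal xC; exists m; rewrite mI.
rewrite !inE => /andP[mI _] mx; apply: contra mI => xI.
by have /forallP/(_ x)/forallP/(_ m) := ideal_setP I; rewrite xI mx.
Qed.

Lemma rowmotion_inj : injective rowmotion_fun.
Proof.
move=> I J /(congr1 (@ideal_set d P)) /= eqIJ; apply: val_inj => /=.
have eqM : minimal_elements (~: (I : {set P})) =
           minimal_elements (~: (J : {set P})).
  by apply/eqP; rewrite eqEsubset !minimal_sub.
by apply/setP => x; apply: negb_inj; rewrite !in_ideal_minimal eqM.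
Qed.

Definition rowmotion : {perm orderIdeal P} := perm rowmotion_inj.

Definition indicator (s : P) (I : orderIdeal P) : rat :=
  (s \in (I : {set P}))%:R%R.

End Rowmotion.

Arguments rowmotion {d} P.

Definition mesic (S : finType) (phi : {perm S}) (g : S -> rat) (c : rat) : Prop :=
  forall O : {set S}, O \in porbits phi ->
    ((\sum_(x in O) g x) / #|O|%:R = c)%R.

Inductive V3 : predArgType := Vc | Vl | Vr.

Definition V3_to_ord (x : V3) : 'I_3 :=
  match x with Vc => inord 0 | Vl => inord 1 | Vr => inord 2 end.
Definition V3_of_ord (i : 'I_3) : V3 :=
  match val i with 0 => Vc | 1 => Vl | _ => Vr end.
Lemma V3_to_ordK : cancel V3_to_ord V3_of_ord.
Proof. by case; rewrite /V3_of_ord /= inordK. Qed.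

HB.instance Definition _ := Finite.copy V3 (can_type V3_to_ordK).

Definition V3_le (x y : V3) : bool := (x == y) || (x == Vc).

Lemma V3_le_refl : reflexive V3_le.
Proof. by move=> x; rewrite /V3_le eqxx. Qed.
Lemma V3_le_anti : antisymmetric V3_le.
Proof. by move=> x y /andP[/orP[]/eqP-> // /orP[]/eqP->]. Qed.
Lemma V3_le_trans : transitive V3_le.
Proof.
by move=> y x z /orP[]/eqP-> //; rewrite /V3_le eqxx orbT.
Qed.

Fact V3_display : Order.disp_t. Proof. exact: (Order.Disp tt tt). Qed.
HB.instance Definition _ :=
  Order.Le_isPOrder.Build V3_display V3 V3_le_refl V3_le_anti V3_le_trans.

(* The chain [k] is 'I_k: the element i of [k] is the ordinal of value
   i - 1. *)
Notation Vk k := (V3 *p 'I_k)%type.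

Definition l_ (k : nat) (i : 'I_k) : Vk k := (Vl, i).
Definition c_ (k : nat) (i : 'I_k) : Vk k := (Vc, i).
Definition r_ (k : nat) (i : 'I_k) : Vk k := (Vr, i).

Definition first_index (k : nat) (hk : 1 <= k) : 'I_k := Ordinal hk.
Definition last_index (k : nat) (hk : 1 <= k) : 'I_k :=
  Ordinal (etrans (ltn_predL k) hk).

(* Main.v *)
(** An order ideal of [V x [k]] is determined by the numbers [(a, b, c)] of its
    elements on the chains over [l], [r] and [c].  On such triples rowmotion
    increments every coordinate, except that [a] or [b] is reset to [0] when it
    equals [c], and that [c], when it equals [k], drops to the larger of the
    new [a] and [b].  Every orbit meets a triple of the form [(m, y, m)], up to
    exchanging [a] and [b].  If [y < m], then after [k - m + 1] steps the triple
    becomes [(k - m, m', m')] with [m' = y + k - m + 1], and doing this three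
    times yields [(y, m, m)] after [k + 2] steps in all; the triple [(m, m, m)]
    returns to itself in [k + 2] steps.  Hence the [k + 2]nd power of rowmotion
    exchanges [l] and [r], which gives (1).  For (2), the number of resets of
    [a], resets of [b] and drops of [c] among [k + 2] consecutive steps is
    always [6], and [a] (or [b]) vanishes exactly after a reset, so that the
    average is [2 - 6 / (k + 2)]. *)

Require Import Defs.
From HB Require Import structures.
From mathcomp Require Import all_boot all_order all_fingroup all_algebra.
From mathcomp Require Import zify ring lra.
Import Order.Theory GRing.Theory Num.Theory.
Local Open Scope ring_scope.

Set Implicit Arguments.
Unset Strict Implicit.
Unset Printing Implicit Defensive.

(** * Orbit sums *)

Section OrbitSums.
Variables (S : finType) (phi : {perm S}).

Lemma porbits_expg (O : {set S}) n x :
  O \in porbits phi -> ((phi ^+ n)%g x \in O) = (x \in O).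
Proof.
case/imsetP=> y _ ->; rewrite -!eq_porbit_mem; congr (_ == _).
by apply/eqP; rewrite eq_porbit_mem mem_porbit.
Qed.

Lemma big_porbits_expg (R : Type) (idx : R) (op : Monoid.com_law idx)
    (O : {set S}) n (f : S -> R) :
  O \in porbits phi ->
  \big[op/idx]_(x in O) f ((phi ^+ n)%g x) = \big[op/idx]_(x in O) f x.
Proof.
move=> porO; rewrite [RHS](reindex_inj (@perm_inj _ (phi ^+ n)%g)) /=.
by apply: eq_bigl => x; rewrite porbits_expg.
Qed.

Lemma porbits_card_gt0 (O : {set S}) : O \in porbits phi -> (0 < #|O|)%N.
Proof. by case/imsetP=> x _ ->; rewrite (cardD1 x) porbit_id. Qed.

(** Double counting: powers of [phi] permute the orbit, so each of the [n] shifted sums equals the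
    orbit sum. The orbit size need not divide [n]. *)
Lemma sum_porbits_window (O : {set S}) n s (f : S -> nat) :
  O \in porbits phi ->
  (forall x, x \in O -> \sum_(i < n) f ((phi ^+ i)%g x) = s)%N ->
  (n * \sum_(x in O) f x = #|O| * s)%N.
Proof.
move=> porO fs; rewrite -sum_nat_const -(eq_bigr _ fs) exchange_big /=.
rewrite [RHS](eq_bigr (fun=> \sum_(x in O) f x)%N) => [|i _].
  by rewrite sum_nat_const card_ord.
exact: big_porbits_expg.
Qed.

End OrbitSums.

(** * Rowmotion on triples of heights *)

Local Open Scope nat_scope.

Section Triples.
Variable k : nat.

Local Notation triple := (nat * nat * nat)%type.
Implicit Types t u v : triple.

Definition raise a c := if a < c then a.+1 else 0.

Definition step t : triple :=
  let: (a, b, c) := t in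
  (raise a c, raise b c, if c < k then c.+1 else maxn (raise a c) (raise b c)).

Definition flip t : triple := let: (a, b, c) := t in (b, a, c).

(* The number of resets and drops performed by [step]. *)
Definition weight t : nat :=
  let: (a, b, c) := t in (a == c) + (b == c) + (c == k).

(** End point and accumulated weight travel together, so that composing runs adds both lengths and
    weights. *)
Definition run n s t u :=
  iter n step t = u /\ \sum_(i < n) weight (iter i step t) = s.

Lemma run_trans n1 n2 s1 s2 t u v :
  run n1 s1 t u -> run n2 s2 u v -> run (n1 + n2) (s1 + s2) t v.
Proof.
move=> [tu <-] [uv <-]; split; first by rewrite addnC iterD tu.
rewrite big_split_ord /=; congr addn; apply: eq_bigr => i _.
by rewrite addnC iterD tu.
Qed.

Lemma run1 t : run 1 (weight t) t (step t).
Proof. by split=> //; rewrite big_ord1. Qed.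

Lemma run_step n s t u : run n s (step t) u -> run n.+1 (weight t + s) t u.
Proof. by move=> r; apply: (run_trans (run1 t) r). Qed.

Lemma flip_step t : step (flip t) = flip (step t).
Proof. by case: t => [[a b] c] /=; rewrite maxnC. Qed.

Lemma flip_iter_step n t : iter n step (flip t) = flip (iter n step t).
Proof. by elim: n => //= n ->; rewrite flip_step. Qed.

Lemma weight_flip t : weight (flip t) = weight t.
Proof. by case: t => [[a b] c] /=; rewrite (addnC (b == c)). Qed.

Lemma run_flip n s t u : run n s t u -> run n s (flip t) (flip u).
Proof.
move=> [<- <-]; split; first exact: flip_iter_step.
by apply: eq_bigr => i _; rewrite flip_iter_step weight_flip.
Qed.

(** * Runs between consecutive triples in which [c] meets [a] or [b] *)

Lemma run_climb j a b c : a < c -> b < c -> c + j <= k ->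
  run j 0 (a, b, c) (a + j, b + j, c + j).
Proof.
elim: j a b c => [|j IHj] a b c ac bc cjk.
  by rewrite !addn0; split; rewrite // big_ord0.
have -> : 0 = weight (a, b, c) + 0 by rewrite /=; lia.
apply: run_step; rewrite /= /raise ac bc (_ : c < k); last by lia.
by rewrite !addnS -!addSn; apply: IHj; lia.
Qed.

Lemma run_congr n s t u n' s' u' :
  run n s t u -> n = n' -> s = s' -> u = u' -> run n' s' t u'.
Proof. by move=> tu <- <- <-. Qed.

(** The first coordinate is reset, all three climb until [c] is [k], and [c] drops to the second
    one: one reset and one drop. For [m = k] both occur in a single step. *)
Lemma run_turn m y : y < m -> m <= k ->
  run (k - m).+1 2 (m, y, m) (k - m, y + (k - m).+1, y + (k - m).+1).
Proof.
move=> ym; rewrite leq_eqVlt => /predU1P[mk|mk].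
  apply: run_congr (run1 _) _ _ _ => /=; try lia.
  by rewrite /raise mk ltnn -mk ym subnn addn1 max0n.
have climb : run (k - m.+1) 0 (0, y.+1, m.+1) (k - m.+1, y + (k - m), k).
  by apply: run_congr (run_climb _ _ _) _ _ _; rewrite ?addSnnS; try lia;
    do ?congr pair; lia.
have first : run 1 1 (m, y, m) (0, y.+1, m.+1).
  by apply: run_congr (run1 _) _ _ _; rewrite //= ?/raise ?ltnn ?ym ?mk //; lia.
have last : run 1 1 (k - m.+1, y + (k - m), k)
                    (k - m, y + (k - m).+1, y + (k - m).+1).
  apply: run_congr (run1 _) _ _ _; rewrite //= ?/raise; try lia.
  by rewrite ltnn !ifT; try lia; do ?congr pair; lia.
by apply: run_congr (run_trans first (run_trans climb last)) _ _ _; rewrite //; lia.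
Qed.

Lemma run_turn_diag m : m <= k ->
  run (k - m).+1 3 (m, m, m) (k - m, k - m, k - m).
Proof.
rewrite leq_eqVlt => /predU1P[mk|mk].
  apply: run_congr (run1 _) _ _ _ => /=; try lia.
  by rewrite /raise mk ltnn subnn.
have climb : run (k - m.+1) 0 (0, 0, m.+1) (k - m.+1, k - m.+1, k).
  by apply: run_congr (run_climb _ _ _) _ _ _; try lia; do ?congr pair; lia.
have first : run 1 2 (m, m, m) (0, 0, m.+1).
  by apply: run_congr (run1 _) _ _ _; rewrite //= ?/raise ?ltnn ?mk //; lia.
have last : run 1 1 (k - m.+1, k - m.+1, k) (k - m, k - m, k - m).
  apply: run_congr (run1 _) _ _ _; rewrite //= ?/raise; try lia.
  by rewrite ltnn !ifT; try lia; do ?congr pair; lia.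
by apply: run_congr (run_trans first (run_trans climb last)) _ _ _; rewrite //; lia.
Qed.

(** * Exchange of the upper chains after [k + 2] steps *)

Definition flips t := run k.+2 6 t (flip t).

Lemma flips_flip t : flips t -> flips (flip t).
Proof. exact: run_flip. Qed.

Lemma flips_touching m y : y <= m -> m <= k -> flips (m, y, m).
Proof.
rewrite leq_eqVlt => /predU1P[->|ym] mk.
  have mk' : k - m <= k by lia.
  apply: run_congr (run_trans (run_turn_diag mk) (run_turn_diag mk')) _ _ _;
    by rewrite ?subKn //; lia.
have turn1 := run_turn ym mk.
(* The second turn is used with [a] and [b] exchanged, since the first ends with [b] equal to [c].
   The lengths [k - m + 1], [m - y] and [y + 1] add up to [k + 2], and each turn has weight 2. *)
have turn2 := @run_turn (y + (k - m).+1) (k - m) ltac:(lia) ltac:(lia).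
have turn3 := @run_turn (k - y) (m - y).-1 ltac:(lia) ltac:(lia).
have eq23 : flip (k - (y + (k - m).+1), k - m + (k - (y + (k - m).+1)).+1,
                  k - m + (k - (y + (k - m).+1)).+1) =
            (k - y, (m - y).-1, k - y).
  by do ?congr pair; lia.
have turn2' := run_flip turn2; rewrite eq23 in turn2'.
apply: run_congr (run_trans turn1 (run_trans turn2' turn3)) _ _ _; try lia.
by rewrite /=; do ?congr pair; lia.
Qed.

Lemma flips_max a b : maxn a b <= k -> flips (a, b, maxn a b).
Proof.
case: (leqP b a) => [ba|ab] mk; first exact: flips_touching.
exact: flips_flip (flips_touching (ltnW ab) mk).
Qed.

(** Moving the window by one step removes the weight of [t] and adds that of [flip t], which is the
    same. *)
Lemma flips_step t : flips t -> flips (step t).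
Proof.
move=> [tN t6]; split; first by rewrite -iterSr iterS tN flip_step.
apply: (@addnI (weight t)); rewrite -t6.
transitivity (\sum_(i < k.+3) weight (iter i step t)).
  by rewrite [RHS]big_ord_recl; congr addn; apply: eq_bigr => i _; rewrite -iterSr.
by rewrite big_ord_recr [X in _ (weight X) = _]tN weight_flip addnC.
Qed.

Lemma flips_iter_step n t : flips t -> flips (iter n step t).
Proof. by move=> ft; elim: n => //= n; apply: flips_step. Qed.

Lemma eventually_flips a b c : a <= c -> b <= c -> c <= k ->
  exists n, flips (iter n step (a, b, c)).
Proof.
move=> ac bc ck; have [abc|abc] := eqVneq (maxn a b) c.
  by exists 0; rewrite -abc; apply: flips_max; lia.
(* Climb until [c] is [k]; one more step drops [c] to the maximum of the new [a] and [b]. *)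
exists (k - c).+1; rewrite iterS.
have [||| -> _] := @run_climb (k - c) a b c; try lia.
rewrite subnKC //= /raise ltnn !ifT; try lia.
by apply: flips_max; lia.
Qed.

End Triples.

(** * Heights of order ideals *)

Section Heights.
Variable k : nat.
Implicit Types (I : orderIdeal (Vk k)) (v : V3) (i : 'I_k).

Lemma Vk_le v w i j :
  ((v, i) <= (w, j) :> Vk k)%O = ((v == w) || (v == Vc)) && (i <= j).
Proof. by []. Qed.

Definition height I v := #|[set i : 'I_k | ((v, i) : Vk k) \in (I : {set Vk k})]|.

Lemma height_le I v : height I v <= k.
Proof. by rewrite -[X in _ <= X]card_ord max_card. Qed.

Lemma ideal_le I (x y : Vk k) :
  (y <= x)%O -> x \in (I : {set Vk k}) -> y \in (I : {set Vk k}).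
Proof.
by move=> yx xI; have /forallP/(_ x)/forallP/(_ y) := ideal_setP I; rewrite xI yx.
Qed.

Lemma card_ord_lt (m : nat) : m <= k -> #|[set i : 'I_k | i < m]| = m.
Proof.
move=> mk; rewrite -sum1_card -[RHS]card_ord -sum1_card.
rewrite (big_ord_widen_cond k predT (fun=> 1)) //.
by apply: eq_bigl => i; rewrite inE.
Qed.

(** An ideal meets each chain in an initial segment; the inequality is strict because indices start
    at 0. *)
Lemma mem_height I v i : (((v, i) : Vk k) \in (I : {set Vk k})) = (i < height I v).
Proof.
apply/idP/idP => [vi|]; last apply: contraLR => /negP vi; rewrite -?leqNgt.
  rewrite -(card_ord_lt (ltn_ord i)); apply/subset_leq_card/subsetP => j.
  by rewrite !inE ltnS => ji; apply: ideal_le vi; rewrite Vk_le eqxx.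
rewrite -[X in _ <= X](card_ord_lt (ltnW (ltn_ord i))).
apply/subset_leq_card/subsetP => j; rewrite !inE => vj.
rewrite ltnNge; apply/negP => ij; apply: vi.
by apply: ideal_le vj; rewrite Vk_le eqxx.
Qed.

Lemma heightP I v m :
  m <= k -> (forall i, (((v, i) : Vk k) \in (I : {set Vk k})) = (i < m)) ->
  height I v = m.
Proof.
move=> mk Im; rewrite -[RHS](card_ord_lt mk).
by congr #|pred_of_set _|; apply/setP => i; rewrite !inE Im.
Qed.

Lemma height_Vc I v : height I v <= height I Vc.
Proof.
apply/subset_leq_card/subsetP => i; rewrite !inE => vi.
by apply: ideal_le vi; rewrite Vk_le eqxx orbT leqnn.
Qed.

(** * Rowmotion of ideals expressed by heights *)

Lemma mem_rowmotion I (x : Vk k) :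
  reflect (exists m : Vk k, [/\ m \notin (I : {set Vk k}),
             (forall y, (y < m)%O -> y \in (I : {set Vk k})) & (x <= m)%O])
          (x \in (rowmotion (Vk k) I : {set Vk k})).
Proof.
rewrite permE /= inE; apply: (iffP existsP) => -[m].
  case/andP; rewrite !inE => /andP[mI /forallP min_m] xm; exists m; split=> // y.
  by move=> ym; apply: contraTT (min_m y); rewrite !inE ym => ->.
case=> mI min_m xm; exists m; rewrite !inE mI xm andbT.
apply/forallP => y; apply/implyP; rewrite !inE; exact/contra/min_m.
Qed.

Lemma minimal_outside I v j :
  ((v, j) : Vk k) \notin (I : {set Vk k}) /\
    (forall y, (y < (v, j) :> Vk k)%O -> y \in (I : {set Vk k})) <->
  (j = height I v :> nat) /\ (v != Vc -> j < height I Vc).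
Proof.
rewrite mem_height -leqNgt; split=> [[vj min_vj]|[jv jc]]; last first.
  split=> [|[w i]]; first by rewrite jv.
  rewrite lt_neqAle Vk_le xpair_eqE mem_height => /andP[ne /andP[wv ij]].
  move: wv ne => /predU1P[->|/eqP ->]; first by rewrite eqxx /= -jv ltn_neqAle => ->.
  case: (eqVneq v Vc) jv jc => [-> jv _|_ _ /(_ isT) jc _].
    by rewrite /= -jv ltn_neqAle => ->.
  exact: leq_ltn_trans ij jc.
split=> [|vc].
  apply/eqP; rewrite eqn_leq vj andbT leqNgt; apply/negP => hj.
  pose i := Ordinal (ltn_trans hj (ltn_ord j)).
  have /min_vj : ((v, i) < (v, j) :> Vk k)%O.
    by rewrite lt_neqAle Vk_le xpair_eqE eqxx /= -val_eqE /= -ltn_neqAle.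
  by rewrite mem_height ltnn.
have /min_vj : ((Vc, j) < (v, j) :> Vk k)%O.
  by rewrite lt_neqAle Vk_le xpair_eqE !eqxx leqnn orbT !andbT eq_sym.
by rewrite mem_height.
Qed.

(** Here [w] is the chain of a generator, whose index is [height I w]; the last bound says that this
    chain does carry a minimal element of the complement. *)
Lemma mem_rowmotion_height I v i :
  (((v, i) : Vk k) \in (rowmotion (Vk k) I : {set Vk k})) =
  [exists w, [&& (v == w) || (v == Vc), i <= height I w &
                 height I w < if w == Vc then k else height I Vc]].
Proof.
apply/mem_rowmotion/existsP => [[[w j] []]|[w /and3P[vw iw]]].
  move=> wj min_wj; rewrite Vk_le => /andP[vw ij]; exists w.
  have [<- jc] := (minimal_outside I w j).1 (conj wj min_wj).
  by rewrite vw ij /=; case: (eqVneq w Vc) jc => [_ _|_ /(_ isT)].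
move=> wk; have hk : height I w < k.
  by case: eqP wk => // _ wc; apply: leq_trans wc (height_le _ _).
have [|wj min_wj] := (minimal_outside I w (Ordinal hk)).2.
  by split=> // /negPf wc; rewrite wc in wk.
by exists (w, Ordinal hk); rewrite Vk_le vw.
Qed.

Lemma height_rowmotion_upper I v : v != Vc ->
  height (rowmotion (Vk k) I) v = raise (height I v) (height I Vc).
Proof.
move=> vc; apply: heightP => [|i].
  by rewrite /raise; case: ifP => // hv; apply: leq_trans hv (height_le _ _).
rewrite mem_rowmotion_height /raise.
apply/existsP/idP => [[w]|].
  rewrite (negPf vc) orbF => /and3P[/eqP <- iv]; rewrite (negPf vc) => ->.
  by rewrite ltnS.
by case: ifP => // hv iv; exists v; rewrite eqxx (negPf vc) hv -ltnS iv.
Qed.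

(** While the central chain is not full, its own generator reaches at least as high as the others;
    once it is full, only generators on the upper chains remain. *)
Lemma height_rowmotion_Vc I :
  height (rowmotion (Vk k) I) Vc =
  if height I Vc < k then (height I Vc).+1
  else maxn (raise (height I Vl) (height I Vc))
            (raise (height I Vr) (height I Vc)).
Proof.
have [[hl hr] hc] := (height_Vc I Vl, height_Vc I Vr, height_le I Vc).
apply: heightP => [|i]; first by rewrite /raise; (do ?case: ifP => ?); lia.
rewrite mem_rowmotion_height; apply/existsP/idP => [[]|].
  by case=> /and3P[_ iw] /=; rewrite /raise; (do ?case: ifP => ?); lia.
have [ck|ck] := ltnP (height I Vc) k => ih.
  by exists Vc; rewrite !eqxx /= ck -ltnS ih.
move: ih; rewrite leq_max => /orP[] ih; [exists Vl | exists Vr];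
  by rewrite eqxx orbT /=; move: ih; rewrite /raise; (do ?case: ifP => ?); lia.
Qed.

Definition heights I := (height I Vl, height I Vr, height I Vc).

Lemma heights_rowmotion I : heights (rowmotion (Vk k) I) = step k (heights I).
Proof.
by rewrite /heights height_rowmotion_Vc !height_rowmotion_upper //; apply/eqP.
Qed.

Lemma heights_expg I n :
  heights ((rowmotion (Vk k) ^+ n)%g I) = iter n (step k) (heights I).
Proof.
elim: n => [|n IHn] /=; first by rewrite expg0 perm1.
by rewrite expgSr permM heights_rowmotion IHn.
Qed.

Lemma flips_heights I : flips k (heights I).
Proof.
have [n fn] := eventually_flips (height_Vc I Vl) (height_Vc I Vr) (height_le I Vc).
rewrite -/(heights I) -heights_expg in fn.
(* Rowmotion is invertible on a finite set, so [I] is itself a later iterate of the ideal already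
   treated. *)
have : I \in porbit (rowmotion (Vk k)) ((rowmotion (Vk k) ^+ n)%g I).
  by rewrite porbit_sym mem_porbit.
by case/porbitP => m ->; rewrite heights_expg; apply: flips_iter_step.
Qed.

Lemma mem_l_rowmotion I i :
  (l_ i \in ((rowmotion (Vk k) ^+ k.+2)%g I : {set Vk k})) =
  (r_ i \in (I : {set Vk k})).
Proof.
have [heq _] := flips_heights I.
move: heq; rewrite -heights_expg => -[hl _ _].
by rewrite !mem_height hl.
Qed.

End Heights.

(** * The two orbit averages *)

Local Open Scope ring_scope.

Theorem theorem3p3 (k : nat) (hk : (1 <= k)%N) :
  (forall i : 'I_k,
     mesic (rowmotion (Vk k))
       (fun I => indicator (l_ i) I - indicator (r_ i) I) 0) /\
  mesic (rowmotion (Vk k))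
    (fun I => indicator (l_ (first_index hk)) I
              + indicator (r_ (first_index hk)) I
              - indicator (c_ (last_index hk)) I)
    (2%:R * (k%:R - 1) / (k%:R + 2%:R)).
Proof.
split=> [i|] O porO.
  rewrite sumrB -(big_porbits_expg _ k.+2 (indicator (l_ i)) porO).
  under eq_bigr do rewrite /indicator mem_l_rowmotion.
  by rewrite subrr mul0r.
have /(congr1 (fun n => n%:R : rat)) :
    (k.+2 * \sum_(I in O) weight k (heights I) = #|O| * 6)%N.
  apply: (sum_porbits_window porO) => I _.
  rewrite -(flips_heights I).2; apply: eq_bigr => i _.
  by rewrite heights_expg.
rewrite !natrM natr_sum -natr1 -[k.+1%:R]natr1.
set W := \sum_(I in O) _ => eqW.
rewrite sumrB big_split /=.
(* Only the indicators of the upper chains are moved one step ahead: an upper height is positive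
   after a step exactly when it was not reset. With [c_k] read before the step, the summand is 2
   minus the weight. *)
rewrite -(big_porbits_expg _ 1 (indicator (l_ _)) porO).
rewrite -(big_porbits_expg _ 1 (indicator (r_ _)) porO).
rewrite -big_split -sumrB /=.
rewrite (eq_bigr (fun I => 2 - (weight k (heights I))%:R)) => [|I _].
  have O0 : #|O|%:R != 0 :> rat by rewrite pnatr_eq0 -lt0n (porbits_card_gt0 porO).
  have k0 : k%:R + 2 != 0 :> rat by rewrite -natrD pnatr_eq0 addn2.
  have eqW' : W = #|O|%:R * 6 / (k%:R + 2) by rewrite -eqW; field.
  by rewrite sumrB sumr_const -/W eqW' -mulr_natr; field; rewrite O0 k0.
rewrite /indicator !mem_height expg1 !height_rowmotion_upper; try exact/eqP.
have [[hl hr] hc] := (height_Vc I Vl, height_Vc I Vr, height_le I Vc).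
have -> : (last_index hk < height I Vc)%N = (height I Vc == k) by rewrite /=; lia.
have pos a : (a <= height I Vc)%N ->
    (first_index hk < raise a (height I Vc))%N = ~~ (a == height I Vc).
  by rewrite /raise /=; (do ?case: ifP => ?); lia.
rewrite !pos // !natrD.
by case: eqP; case: eqP; case: eqP => _ _ _ /=; lra.
Qed.
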